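(* Let $n\in\mathbb{N}$, $n\geqslant 2$, with unique prime factorization $n=p_1^{m_1}\cdots p_k^{m_k}$. In the quantale of ideals of the ring $\mathbb{Z}_n$, consider an element $$x:=(l)=(\gcd(l,n))=\left(p_1^{m'_1}\cdots p_k^{m'_k}\right).$$ Then $x$ is a $\mu$-element if and only if there do not exist $i,j,s\in\{1,\ldots,k\}$ such that $i\neq j$, $m'_i<m_i$, $m'_j<m_j$ and $m'_s=m_s$. In particular, $x$ is essential if and only if $m'_i<m_i$ for every $i\in\{1,\ldots,k\}$.
   Context: $\mathbb{Z}_n=\mathbb{Z}/n\mathbb{Z}$; the $p_i$ are distinct primes and $m_i\geqslant 1$. Every ideal of $\mathbb{Z}_n$ is generated by the class of some integer $l$, and equals the ideal generated by the class of $\gcd(l,n)=p_1^{m'_1}\cdots p_k^{m'_k}$, where $0\leqslant m'_i\leqslant m_i$. The ideals of $\mathbb{Z}_n$ form a quantale under inclusion, with meet given by intersection, join by sum, multiplication by ideal product, bottom $(0)$ and top the whole ring. In such a lattice with bottom $0$, an element $x$ is a $\mu$-element if for every natural number $r\geqslant 2$ and all elements $y_1,\ldots,y_r$ with $\bigwedge_{t=1}^r y_t\neq 0$, the condition $x\wedge y_t\neq 0$ for every $t$ implies $x\wedge\bigl(\bigwedge_{t=1}^r y_t\bigr)\neq 0$. An element $x$ is essential if $x\wedge y\neq 0$ for all $y\neq 0$. *)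

(* Defs.v *)
From HB Require Import structures.
From mathcomp Require Import all_boot all_order all_algebra.

Set Implicit Arguments.
Unset Strict Implicit.
Unset Printing Implicit Defensive.

Import Order.Theory GRing.Theory.
Local Open Scope ring_scope.

(* The multiplication of a quantale plays no role in the notions of
   mu-element and essential element, so they are stated for bounded lattices. *)
Section LatticeElements.
Context {d : Order.disp_t} {L : tbLatticeType d}.
Local Open Scope order_scope.

Definition mu_element (x : L) : Prop :=
  forall (r : nat) (y : 'I_r -> L), (2 <= r)%N ->
    \meet_(t < r) y t != \bot ->
    (forall t, x `&` y t != \bot) ->
    x `&` (\meet_(t < r) y t) != \bot.

Definition essential (x : L) : Prop :=
  forall y : L, y != \bot -> x `&` y != \bot.

End LatticeElements.

(* On a finite lattice, finite joins are arbitrary joins. *)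
Record commutative_integral_quantale d (L : finTBLatticeType d)
    (mul : L -> L -> L) : Prop := {
  quantale_mulA : associative mul;
  quantale_mulC : commutative mul;
  quantale_mul1 : left_id (\top)%O mul;
  quantale_mul_join : forall (a : L) (B : {set L}),
    mul a (\join_(b in B) b)%O = (\join_(b in B) mul a b)%O
}.

(* MathComp's [idealr] only covers proper ideals, whereas the lattice of ideals
   has the whole ring as top, hence the following type. *)
Section Ideals.
Context {R : finComNzRingType}.

Definition is_ideal (I : {set R}) : bool :=
  [&& 0 \in I,
      [forall x in I, forall y in I, x - y \in I] &
      [forall a, forall x in I, a * x \in I]].

Lemma is_idealP (I : {set R}) :
  reflect [/\ 0 \in I, {in I &, forall x y, x - y \in I}
            & forall a, {in I, forall x, a * x \in I}] (is_ideal I).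
Proof.
apply: (iffP and3P) => -[I0 IB IM]; split=> //.
- by move=> x y Ix Iy; apply: (forall_inP (forall_inP IB x Ix)).
- by move=> a; apply/forall_inP/(forallP IM).
- by apply/forall_inP => x Ix; apply/forall_inP => y; apply: IB.
- by apply/forallP => a; apply/forall_inP => x; apply: IM.
Qed.

Lemma is_ideal_submod_closed (I : {set R}) :
  is_ideal I <-> submod_closed (I : {pred R^o}).
Proof.
split=> [/is_idealP[I0 IB IM] | [I0 IL]].
  split=> // a u v Iu Iv; have IN : - v \in I by rewrite -sub0r; apply: IB.
  by rewrite -[v]opprK; apply: IB => //; apply: IM.
apply/is_idealP; split=> // [x y Ix Iy | a x Ix].
  by have := IL (-1) y x Iy Ix; rewrite scaleN1r addrC.
by have := IL a x 0 Ix I0; rewrite addr0.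
Qed.

End Ideals.

Record ideal (R : finComNzRingType) := Ideal {
  ideal_set :> {set R};
  ideal_setP : is_ideal ideal_set
}.

HB.instance Definition _ (R : finComNzRingType) :=
  [isSub for @ideal_set R].
HB.instance Definition _ (R : finComNzRingType) :=
  [Finite of ideal R by <:].

Section IdealQuantale.
Context {R : finComNzRingType}.
Implicit Types (I J K : ideal R) (A : {set R}).

Lemma ideal0 I : 0 \in (I : {set R}).
Proof. by case: (is_idealP _ (ideal_setP I)). Qed.

Lemma idealB I x y : x \in (I : {set R}) -> y \in (I : {set R}) ->
  x - y \in (I : {set R}).
Proof. by case: (is_idealP _ (ideal_setP I)) => _ H _; apply: H. Qed.

Lemma idealM I a x : x \in (I : {set R}) -> a * x \in (I : {set R}).
Proof. by case: (is_idealP _ (ideal_setP I)) => _ _ H; apply: H. Qed.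

Lemma idealD I x y : x \in (I : {set R}) -> y \in (I : {set R}) ->
  x + y \in (I : {set R}).
Proof.
move=> Ix Iy; rewrite -[y]opprK; apply: idealB => //.
by rewrite -sub0r; apply: idealB => //; apply: ideal0.
Qed.

Lemma ideal_eqP I J : (I : {set R}) =i (J : {set R}) <-> I = J.
Proof. by split=> [/setP/val_inj | ->]. Qed.

Fact zero_ideal_proof : is_ideal ([set 0] : {set R}).
Proof.
apply/is_idealP; split; first by rewrite inE.
  by move=> x y /set1P-> /set1P->; rewrite subr0 inE.
by move=> a x /set1P->; rewrite mulr0 inE.
Qed.
Definition zero_ideal := Ideal zero_ideal_proof.

Fact unit_ideal_proof : is_ideal [set: R].
Proof. by apply/is_idealP; split=> [|x y _ _|a x _]; rewrite in_setT. Qed.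
Definition unit_ideal := Ideal unit_ideal_proof.

Fact meet_ideal_proof I J : is_ideal (I :&: J).
Proof.
apply/is_idealP; split; first by rewrite inE !ideal0.
  by move=> x y /setIP[Ix Jx] /setIP[Iy Jy]; rewrite inE !idealB.
by move=> a x /setIP[Ix Jx]; rewrite inE !idealM.
Qed.
Definition meet_ideal I J := Ideal (meet_ideal_proof I J).

Fact sum_ideal_proof I J : is_ideal [set x + y | x in I, y in J].
Proof.
apply/is_idealP; split.
- by apply/imset2P; exists 0 0; rewrite ?ideal0 ?addr0.
- move=> _ _ /imset2P[x y Ix Jy ->] /imset2P[z t Iz Jt ->].
  apply/imset2P; exists (x - z) (y - t); rewrite ?idealB //.
  by rewrite opprD addrACA.
- move=> a _ /imset2P[x y Ix Jy ->].
  by apply/imset2P; exists (a * x) (a * y); rewrite ?idealM ?mulrDr.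
Qed.
Definition sum_ideal I J := Ideal (sum_ideal_proof I J).

Fact principal_ideal_proof (a : R) : is_ideal [set b * a | b : R].
Proof.
apply/is_idealP; split.
- by apply/imsetP; exists 0; rewrite ?mul0r.
- move=> _ _ /imsetP[x _ ->] /imsetP[y _ ->].
  by apply/imsetP; exists (x - y); rewrite ?mulrBl.
- move=> b _ /imsetP[x _ ->].
  by apply/imsetP; exists (b * x); rewrite ?mulrA.
Qed.
Definition principal_ideal (a : R) := Ideal (principal_ideal_proof a).

Fact generated_ideal_proof A :
  is_ideal (\bigcap_(I : ideal R | A \subset I) (I : {set R})).
Proof.
apply/is_idealP; split; first by apply/bigcapP => I _; apply: ideal0.
  move=> x y /bigcapP Hx /bigcapP Hy; apply/bigcapP => I AI.
  by apply: idealB; [apply: Hx | apply: Hy].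
by move=> a x /bigcapP Hx; apply/bigcapP => I AI; apply/idealM/Hx.
Qed.
Definition generated_ideal A := Ideal (generated_ideal_proof A).

Definition mul_ideal I J :=
  generated_ideal [set x * y | x in I, y in J].

Definition le_ideal I J := (I : {set R}) \subset J.

Fact le_ideal_refl : reflexive le_ideal.
Proof. by move=> I; apply: subxx. Qed.

Fact le_ideal_anti : antisymmetric le_ideal.
Proof. by move=> I J IJ; apply/val_inj/eqP; rewrite eqEsubset. Qed.

Fact le_ideal_trans : transitive le_ideal.
Proof. by move=> J I K; apply: subset_trans. Qed.

Fact le_ideal_meet I J K :
  le_ideal I (meet_ideal J K) = le_ideal I J && le_ideal I K.
Proof. exact: subsetI. Qed.

Fact le_ideal_sum I J K :
  le_ideal (sum_ideal I J) K = le_ideal I K && le_ideal J K.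
Proof.
apply/idP/andP => [/subsetP H | [/subsetP IK /subsetP JK]].
  split; apply/subsetP => x Hx; apply: H; apply/imset2P.
    by exists x 0; rewrite ?ideal0 ?addr0.
  by exists 0 x; rewrite ?ideal0 ?add0r.
apply/subsetP => _ /imset2P[x y Ix Jy ->].
by apply: idealD; [apply: IK | apply: JK].
Qed.

Fact le_zero_ideal I : le_ideal zero_ideal I.
Proof. by rewrite /le_ideal sub1set ideal0. Qed.

Fact le_unit_ideal I : le_ideal I unit_ideal.
Proof. exact: subsetT. Qed.

End IdealQuantale.

Fact ideal_display : Order.disp_t. Proof. exact: Order.Disp tt tt. Qed.

HB.instance Definition _ (R : finComNzRingType) :=
  @Order.Le_isPOrder.Build ideal_display (ideal R) (@le_ideal R)
    (@le_ideal_refl R) (@le_ideal_anti R) (@le_ideal_trans R).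
HB.instance Definition _ (R : finComNzRingType) :=
  @Order.POrder_MeetJoin_isLattice.Build ideal_display (ideal R)
    (@meet_ideal R) (@sum_ideal R) (@le_ideal_meet R) (@le_ideal_sum R).
HB.instance Definition _ (R : finComNzRingType) :=
  @Order.hasBottom.Build ideal_display (ideal R)
    (@zero_ideal R) (@le_zero_ideal R).
HB.instance Definition _ (R : finComNzRingType) :=
  @Order.hasTop.Build ideal_display (ideal R)
    (@unit_ideal R) (@le_unit_ideal R).

Section IdealTheory.
Context {R : finComNzRingType}.
Implicit Types (I J K : ideal R).

Lemma leEideal I J : (I <= J)%O = ((I : {set R}) \subset J).
Proof. by []. Qed.

Lemma meetEideal I J : (I `&` J)%O = meet_ideal I J.
Proof. by []. Qed.

Lemma joinEideal I J : (I `|` J)%O = sum_ideal I J.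
Proof. by []. Qed.

Lemma botEideal : (\bot)%O = zero_ideal :> ideal R.
Proof. by []. Qed.

Lemma topEideal : (\top)%O = unit_ideal :> ideal R.
Proof. by []. Qed.

Lemma mul_ideal_leP I J K :
  reflect (forall x y, x \in (I : {set R}) -> y \in (J : {set R}) ->
             x * y \in (K : {set R}))
          (mul_ideal I J <= K)%O.
Proof.
rewrite leEideal; apply: (iffP subsetP) => H.
  move=> x y Ix Jy; apply: H; apply/bigcapP => L /subsetP; apply.
  by apply/imset2P; exists x y.
move=> z /bigcapP; apply; apply/subsetP => _ /imset2P[x y Ix Jy ->].
exact: H.
Qed.

Lemma mem_mul_ideal I J x y : x \in (I : {set R}) -> y \in (J : {set R}) ->
  x * y \in (mul_ideal I J : {set R}).
Proof. by move: x y; apply/mul_ideal_leP. Qed.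

Fact quotient_ideal_proof I K :
  is_ideal [set x | [forall y in (I : {set R}), x * y \in (K : {set R})]].
Proof.
apply/is_idealP; split.
- by rewrite inE; apply/forall_inP => y _; rewrite mul0r ideal0.
- move=> x y; rewrite !inE => /forall_inP Hx /forall_inP Hy.
  by apply/forall_inP => z Iz; rewrite mulrBl idealB ?Hx ?Hy.
- move=> a x; rewrite !inE => /forall_inP Hx.
  by apply/forall_inP => z Iz; rewrite -mulrA idealM ?Hx.
Qed.
Definition quotient_ideal I K := Ideal (quotient_ideal_proof I K).

Lemma mul_ideal_adj I J K :
  (mul_ideal J I <= K)%O = (J <= quotient_ideal I K)%O.
Proof.
apply/mul_ideal_leP/subsetP => H.
  by move=> x Jx; rewrite inE; apply/forall_inP => y Iy; apply: H.
by move=> x y /H; rewrite inE => /forall_inP; apply.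
Qed.

Lemma mul_idealC : commutative (@mul_ideal R).
Proof.
move=> I J; apply: le_anti; apply/andP.
by split; apply/mul_ideal_leP => x y Hx Hy; rewrite mulrC mem_mul_ideal.
Qed.

Lemma mul_idealA : associative (@mul_ideal R).
Proof.
have mulA_le I J K :
    (mul_ideal (mul_ideal I J) K <= mul_ideal I (mul_ideal J K))%O.
  rewrite mul_ideal_adj; apply/mul_ideal_leP => x y Ix Jy; rewrite inE.
  by apply/forall_inP => z Kz; rewrite -mulrA !mem_mul_ideal.
move=> I J K; apply: le_anti; rewrite mulA_le andbT.
rewrite mul_idealC (mul_idealC J) (mul_idealC _ K) (mul_idealC I).
exact: mulA_le.
Qed.

Lemma ideal_mul_quantale : commutative_integral_quantale (@mul_ideal R).
Proof.
split=> [||I|I B]; [exact: mul_idealA | exact: mul_idealC | |].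
  apply: le_anti; apply/andP; split.
    by apply/mul_ideal_leP => x y _; apply: idealM.
  by apply/subsetP => x Ix; rewrite -[x]mul1r mem_mul_ideal ?inE.
apply: le_anti; apply/andP; split.
  rewrite mul_idealC mul_ideal_adj; apply/joinsP => J BJ.
  by rewrite -mul_ideal_adj mul_idealC; exact: joins_sup.
apply/joinsP => J BJ; rewrite mul_idealC mul_ideal_adj.
apply: (@le_trans _ _ (\join_(b in B) b)%O); first exact: joins_sup.
by rewrite -mul_ideal_adj mul_idealC.
Qed.

End IdealTheory.

Lemma ideal_Zn_principal (n : nat) (hn : (1 < n)%N) (I : ideal 'Z_n) :
  exists l : int, I = principal_ideal (l%:~R).
Proof.
have ex : exists d, (0 < d)%N && ((d%:R : 'Z_n) \in (I : {set _})).
  by exists n; rewrite (ltnW hn) pchar_Zp ?ideal0.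
case: (ex_minnP ex) => d /andP[d0 Id] dmin; exists (d%:Z).
apply/ideal_eqP => z; apply/idP/imsetP => [Iz | [b _ ->]]; last exact: idealM.
exists (z %/ d)%:R => //; rewrite -natrM.
suff r0 : (z %% d)%N = 0%N.
  by rewrite -[LHS]natr_Zp {1}(divn_eq z d) r0 addn0.
apply/eqP; rewrite -leqn0 leqNgt; apply/negP => r_gt0.
have := dmin (z %% d)%N; rewrite r_gt0 leqNgt ltn_mod d0 => /(_ _)/negP; apply=> //.
have -> : (z %% d)%:R = z - (z %/ d)%:R * d%:R :> 'Z_n.
  by rewrite -[X in X - _]natr_Zp {2}(divn_eq z d) natrD natrM addrC addKr.
by apply: idealB => //; apply: idealM.
Qed.

Lemma principal_ideal_gcd (n : nat) (hn : (1 < n)%N) (l : int) :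
  principal_ideal (l%:~R : 'Z_n) = principal_ideal ((gcdz l n)%:~R).
Proof.
have n0 : (n%:R : 'Z_n) = 0 by apply: pchar_Zp.
apply/ideal_eqP => z; apply/imsetP/imsetP => -[b _ ->].
  have /dvdzP[c hc] := dvdz_gcdl l n.
  by exists (b * c%:~R); rewrite // {1}hc intrM mulrA.
have [u [v huv]] := Bezoutz l n.
exists (b * u%:~R) => //.
by rewrite -huv intrD !intrM -[n%:~R]/(n%:R) n0 mulr0 addr0 mulrA.
Qed.

(* Main.v *)
Require Import Defs.
From mathcomp Require Import all_boot all_order all_algebra.

Import Order.Theory GRing.Theory.
Local Open Scope ring_scope.

(** The minimal nonzero ideals of [Z_n] are the ideals [(n / p_i)]. Call the set
    of [i] with [(n / p_i) <= I] the support of [I]: an ideal is nonzero iff its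
    support is nonempty, and the support turns meets into intersections. So
    being essential or a mu-element is a property of the support of [x], which
    is the set of [i] with [m'_i < m_i]. If the support is everything, [x] is
    essential; if it is a singleton [{i}], then [i] belongs to the support of
    each [y_t], hence of their meet; and if it contains distinct [i], [j] but
    not [s], then [(n / (p_i p_s))] and [(n / (p_j p_s))], of supports [{i, s}]
    and [{j, s}], violate the condition. *)

Lemma logn_prod_pfactor {I : finType} (p e : I -> nat) (t : I) :
  injective p -> (forall i, prime (p i)) ->
  logn (p t) (\prod_i p i ^ e i) = e t.
Proof.
move=> p_inj p_prime.
have prod_gt0 (P : pred I) : (0 < \prod_(i | P i) p i ^ e i)%N.
  by apply: prodn_cond_gt0 => i _; rewrite expn_gt0 prime_gt0.
rewrite (bigD1 t) //= lognM ?prod_gt0 ?expn_gt0 ?prime_gt0 //.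
rewrite lognX logn_prime ?eqxx // muln1 logn_coprime ?addn0 //.
rewrite prime_coprime // Euclid_dvd_prod // big1 // => i neq_it.
apply/negbTE; rewrite Euclid_dvdX // dvdn_prime2 // eq_sym.
by rewrite (inj_eq p_inj) (negbTE neq_it).
Qed.

Lemma principal_ideal_leP {R : finComNzRingType} (a : R) (I : ideal R) :
  (principal_ideal a <= I)%O = (a \in (I : {set R})).
Proof.
apply/subsetP/idP => [|Ia _ /imsetP[b _ ->]]; last exact: idealM.
by apply; apply/imsetP; exists 1; rewrite ?mul1r.
Qed.

Section IdealsOfZn.
Variables (n : nat) (n_gt1 : (1 < n)%N).

Let nideal (d : nat) : ideal 'Z_n := principal_ideal d%:R.

Lemma mem_principal_Zn (c a : nat) : (c %| n)%N ->
  (a%:R \in (nideal c : {set 'Z_n})) = (c %| a)%N.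
Proof.
move=> c_dvd_n; apply/imsetP/idP => [[b _]|/dvdnP[q ->]]; last first.
  by exists q%:R; rewrite // natrM.
rewrite -[b]natr_Zp -natrM => /(congr1 (fun z : 'Z_n => z : nat)).
(* As [c] divides [n], reducing mod [n] and then mod [c] is the same as reducing mod [c]. *)
rewrite !val_Zp_nat // => /(congr1 (modn^~ c)).
by rewrite !(modn_dvdm _ c_dvd_n) modnMl => /eqP.
Qed.

Lemma principal_Zn_le (c d : nat) : (c %| n)%N ->
  (nideal d <= nideal c)%O = (c %| d)%N.
Proof. by move=> c_dvd_n; rewrite principal_ideal_leP mem_principal_Zn. Qed.

Lemma principal_Zn_eq0 (d : nat) : (nideal d == \bot%O) = (n %| d)%N.
Proof.
rewrite -lex0 principal_ideal_leP inE.
by rewrite -val_eqE /= val_Zp_nat.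
Qed.

Lemma ideal_Zn_dvd (I : ideal 'Z_n) : exists2 d, (d %| n)%N & I = nideal d.
Proof.
have [l ->] := ideal_Zn_principal n_gt1 I; exists (gcdn `|l| n).
  exact: dvdn_gcdr.
exact: principal_ideal_gcd.
Qed.

Variables (k : nat) (p m : 'I_k -> nat).
Hypotheses (p_inj : injective p) (p_prime : forall i, prime (p i)).
Hypotheses (m_gt0 : forall i, (0 < m i)%N).
Hypothesis n_fact : n = (\prod_(i < k) p i ^ m i)%N.

Let atom i : ideal 'Z_n := nideal (n %/ p i).

Let n_gt0 : (0 < n)%N. Proof. exact: ltnW. Qed.

Let p_dvd_n i : (p i %| n)%N.
Proof. by rewrite n_fact (bigD1 i) //= dvdn_mulr // dvdn_exp. Qed.

Lemma principal_Zn_ge_atom (d : nat) (i : 'I_k) : (d %| n)%N ->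
  (atom i <= nideal d)%O = (d * p i %| n)%N.
Proof.
move=> d_dvd_n; rewrite principal_Zn_le //.
rewrite -(dvdn_pmul2r (prime_gt0 (p_prime i))) divnK //.
Qed.

(** Write [I] as [(d)] with [d] dividing [n]. If [d < n], a prime factor of [n / d] is one of the
    [p i], so [d * p i] still divides [n]. Conversely, [d * p i] dividing [n] forces [d < n]. *)
Lemma ideal_Zn_neq0 (I : ideal 'Z_n) :
  I != \bot%O <-> exists i, (atom i <= I)%O.
Proof.
have [d d_dvd_n ->] := ideal_Zn_dvd I.
rewrite principal_Zn_eq0; split=> [n_ndvd_d | [i]]; last first.
  rewrite principal_Zn_ge_atom // => dp_dvd_n; apply/negP => n_dvd_d.
  have := dvdn_leq n_gt0 dp_dvd_n; rewrite leqNgt => /negP; apply.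
  have d_gt0 := dvdn_gt0 n_gt0 d_dvd_n.
  by rewrite (leq_ltn_trans (dvdn_leq d_gt0 n_dvd_d)) // ltn_Pmulr ?prime_gt1.
have nd_gt1 : (1 < n %/ d)%N.
  rewrite ltn_divRL // mul1n ltn_neqAle dvdn_leq // andbT.
  by apply: contraNneq n_ndvd_d => <-.
have q_prime := pdiv_prime nd_gt1.
have q_dvd_nd := pdiv_dvd (n %/ d).
move: (pdiv _) q_prime q_dvd_nd => q q_prime q_dvd_nd.
have : (q %| \prod_(i < k) p i ^ m i)%N.
  by rewrite -n_fact (dvdn_trans q_dvd_nd) ?dvdn_div.
rewrite Euclid_dvd_prod // big_orE => /existsP[i /=].
rewrite Euclid_dvdX // dvdn_prime2 // => /andP[/eqP q_eq _]; exists i.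
by rewrite principal_Zn_ge_atom // -q_eq mulnC -dvdn_divRL.
Qed.

(** The inclusion says that the generator times [p t] divides [n]. This factor raises the exponent
    at [t] by one, and only that exponent can then exceed its bound. *)
Lemma prod_pfactor_ge_atom (e : 'I_k -> nat) (t : 'I_k) :
  (forall i, (e i <= m i)%N) ->
  (atom t <= nideal (\prod_(i < k) p i ^ e i))%O = (e t < m t)%N.
Proof.
move=> e_le; have dvd_prod (e' : 'I_k -> nat) : (forall i, (e' i <= m i)%N) ->
    (\prod_(i < k) p i ^ e' i %| n)%N.
  move=> e'_le; rewrite n_fact; apply: (big_ind2 (fun a b => a %| b)%N) => //.
    by move=> a b c d; apply: dvdn_mul.
  by move=> i _; apply: dvdn_exp2l.
rewrite principal_Zn_ge_atom ?dvd_prod //.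
have -> : (\prod_(i < k) p i ^ e i * p t =
           \prod_(i < k) p i ^ (e i + (i == t)))%N.
  rewrite [in RHS](bigD1 t) //= [in LHS](bigD1 t) //= eqxx addn1 expnSr mulnAC.
  by congr (_ * _)%N; apply: eq_bigr => i /negbTE->; rewrite addn0.
apply/idP/idP => [/(dvdn_leq_log (p t) n_gt0)|et_lt].
  by rewrite n_fact !logn_prod_pfactor // eqxx addn1.
by apply: dvd_prod => i; case: eqP => [->|_]; rewrite ?addn1 ?addn0.
Qed.

Lemma ideal_Zn_of_pair (i s : 'I_k) : i != s ->
  exists I : ideal 'Z_n, forall t, (atom t <= I)%O = (t == i) || (t == s).
Proof.
move=> neq_is; exists (nideal (n %/ (p i * p s))) => t.
have pp_dvd_n : (p i * p s %| n)%N.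
  rewrite Gauss_dvd ?p_dvd_n // prime_coprime // dvdn_prime2 //.
  by rewrite (inj_eq p_inj).
have pp_gt0 : (0 < p i * p s)%N by rewrite muln_gt0 !prime_gt0.
rewrite principal_Zn_ge_atom ?dvdn_div //.
(* Cancelling the cofactor [q] leaves the condition that [p t] divides [p i * p s]. *)
have [q q_gt0 n_eq] : exists2 q, (0 < q)%N & n = (q * (p i * p s))%N.
  exists (n %/ (p i * p s))%N; last by rewrite divnK.
  by rewrite divn_gt0 // dvdn_leq.
rewrite n_eq mulnK // dvdn_pmul2l // Euclid_dvdM // !dvdn_prime2 //.
by rewrite !(inj_eq p_inj).
Qed.

Lemma atom_le_atom (i j : 'I_k) : (atom i <= atom j)%O = (i == j).
Proof.
rewrite principal_Zn_ge_atom ?dvdn_div ?p_dvd_n //.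
have [q q_gt0 n_eq] : exists2 q, (0 < q)%N & n = (q * p j)%N.
  exists (n %/ p j)%N; last by rewrite divnK.
  by rewrite divn_gt0 ?prime_gt0 // dvdn_leq.
rewrite n_eq mulnK ?prime_gt0 // dvdn_pmul2l // dvdn_prime2 //.
by rewrite (inj_eq p_inj).
Qed.

Lemma essential_Zn (x : ideal 'Z_n) :
  essential x <-> forall i, (atom i <= x)%O.
Proof.
split=> [ess_x i | le_x y /ideal_Zn_neq0[i le_iy]]; last first.
  by apply/ideal_Zn_neq0; exists i; rewrite lexI le_x.
(* Test [x] against [atom i]: any atom below their meet lies below [atom i], hence equals it. *)
have /ess_x/ideal_Zn_neq0[j] : atom i != \bot%O.
  by apply/ideal_Zn_neq0; exists i.
by rewrite lexI atom_le_atom => /andP[le_jx /eqP <-].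
Qed.

Lemma mu_element_Zn (x : ideal 'Z_n) :
  mu_element x <->
    ~ exists i j s, [/\ i != j, atom i <= x, atom j <= x & ~~ (atom s <= x)]%O.
Proof.
split=> [mu_x [i [j [s [neq_ij le_ix le_jx nle_sx]]]] | no_ijs r y r_ge2].
  have neq_is : i != s by apply: contraNneq nle_sx => <-.
  have neq_js : j != s by apply: contraNneq nle_sx => <-.
  have [Y YP] := ideal_Zn_of_pair _ _ neq_is.
  have [Z ZP] := ideal_Zn_of_pair _ _ neq_js.
  have := mu_x 2 (fun t => if t == 0 then Y else Z) isT.
  rewrite !big_ord_recl big_ord0 /= meetx1 => mu_YZ.
  have /mu_YZ/(_ _)/ideal_Zn_neq0[] : (Y `&` Z)%O != \bot%O.
  - by apply/ideal_Zn_neq0; exists s; rewrite lexI YP ZP eqxx !orbT.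
  - move=> t; apply/ideal_Zn_neq0; case: ifP => _.
      by exists i; rewrite lexI le_ix YP eqxx.
    by exists j; rewrite lexI le_jx ZP eqxx.
  (* The supports of [Y] and [Z] share only [s], which the support of [x] misses. *)
  move=> t; rewrite !lexI YP ZP => /and3P[le_tx /orP[/eqP t_i|/eqP t_s]].
    by rewrite t_i (negbTE neq_ij) (negbTE neq_is).
  by rewrite t_s (negbTE nle_sx) in le_tx.
move=> /ideal_Zn_neq0[s le_s_meet] xy_neq0; apply/ideal_Zn_neq0.
have [le_sx | nle_sx] := boolP (atom s <= x)%O.
  by exists s; rewrite lexI le_sx.
(* As [r >= 2], the family has an element at index 0; its meet with [x] yields some [i] in the
   support of [x]. *)
have [i] : exists i, (atom i <= x `&` y (Ordinal (ltnW r_ge2)))%O.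
  exact/ideal_Zn_neq0.
rewrite lexI => /andP[le_ix _]; exists i; rewrite lexI le_ix.
(* An atom [j] below [x] and [y t] with [j != i] would complete a forbidden triple with [i] and [s];
   so the same [i] serves every [t]. *)
apply/meetsP => t _; have /ideal_Zn_neq0[j] := xy_neq0 t.
rewrite lexI => /andP[le_jx le_jy]; have [<- //|neq_ji] := eqVneq j i.
by case: no_ijs; exists j, i, s.
Qed.

End IdealsOfZn.

Theorem theorem5p1 (n k : nat) (p m m' : 'I_k -> nat) (l : int)
    (hn : (2 <= n)%N)
    (p_inj : injective p)
    (p_prime : forall i, prime (p i))
    (m_ge1 : forall i, (1 <= m i)%N)
    (n_fact : n = (\prod_(i < k) p i ^ m i)%N)
    (m'_le : forall i, (m' i <= m i)%N)
    (gcd_fact : gcdz l n = (\prod_(i < k) p i ^ m' i)%N :> int) :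
  let x : ideal 'Z_n := principal_ideal (l%:~R) in
  (mu_element x <->
     ~ exists i j s : 'I_k,
         [/\ i != j, (m' i < m i)%N, (m' j < m j)%N & m' s = m s])
  /\ (essential x <-> forall i : 'I_k, (m' i < m i)%N).
Proof.
move=> x.
have le_x i :
    (principal_ideal ((n %/ p i)%:R : 'Z_n) <= x)%O = (m' i < m i)%N.
  rewrite /x principal_ideal_gcd // gcd_fact.
  exact: (prod_pfactor_ge_atom n hn k p m).
split.
  apply: (iff_trans (mu_element_Zn n hn k p m p_inj p_prime m_ge1 n_fact x)).
  (* Given [m' s <= m s], the failure of [m' s < m s] is the equality [m' s = m s]. *)
  split=> no_ijs [i [j [s]]]; rewrite ?le_x => -[neq_ij lt_i lt_j s_eq];
    case: no_ijs; exists i, j, s; rewrite ?le_x; split=> //.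
    by rewrite -leqNgt s_eq.
  by apply/eqP; rewrite eqn_leq m'_le leqNgt.
apply: (iff_trans (essential_Zn n hn k p m p_inj p_prime m_ge1 n_fact x)).
by split=> lt_m i; have := lt_m i; rewrite le_x.
Qed.
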